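(* Assume $m \geq n \geq 2$ and let $1 \leq i < j \leq n$. (a) If $m = n$, then $I_n^{i,j} = L_{j,n+1-i,1}$, and $Z_n^i \cap Z_n^j = \mathbf{V}(L_{j,n+1-i,1})$ is irreducible. (b) If $1 \leq m-n \leq j-i$, then $I_m^{i,j} = L_{j,n+1-i,2}$, and $Z_m^i \cap Z_m^j = \mathbf{V}(L_{j,n+1-i,2})$ is irreducible. (c) If $j-i \leq m-n$ and $m < 2n+2$, then $$I_m^{i,j} = \bigcap_{u=0}^{m-n-(j-i)} L_{j+u,\,m-j-u+1,\,2},$$ and hence the irreducible decomposition of $Z_m^i \cap Z_m^j$ is given by $$Z_m^i \cap Z_m^j = \bigcup_{u=0}^{m-n-(j-i)} \mathbf{V}(L_{j+u,\,m-j-u+1,\,2}).$$ (d) If $m \geq 2n+2$, then $$I_m^{i,j} = \bigcap_{u=0}^{n+1-(j-i)} \left(L_{j+u,\,2n+2-j-u,\,2} + \langle f^{(2n+2)},\ldots,f^{(m)}\rangle\right).$$ The ideal $L_{j+u,\,2n+2-j-u,\,2} + \langle f^{(2n+2)},\ldots,f^{(m)}\rangle$ is prime for $0 \leq u \leq n+1-(j-i)$, and the irreducible decomposition of $Z_m^i \cap Z_m^j$ is given by $$Z_m^i \cap Z_m^j = \bigcup_{u=0}^{n+1-(j-i)} \mathbf{V}\left(L_{j+u,\,2n+2-j-u,\,2} + \langle f^{(2n+2)},\ldots,f^{(m)}\rangle\right).$$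
   Context: Let $f = xy - z^{n+1} \in \mathbb{C}[x,y,z]$ and $X = \mathrm{Spec}\,\mathbb{C}[x,y,z]/\langle f\rangle$, a surface with an $A_n$-type singularity at the origin. For $m \geq 0$ let $R_m = \mathbb{C}[x_0,\ldots,x_m,y_0,\ldots,y_m,z_0,\ldots,z_m]$, and define $f^{(0)},\ldots,f^{(m)} \in R_m$ by $f(\sum_{k=0}^m x_kt^k, \sum_{k=0}^m y_kt^k, \sum_{k=0}^m z_kt^k) \equiv \sum_{k=0}^m f^{(k)}t^k \pmod{t^{m+1}}$ (the polynomial $f^{(k)}$ does not depend on $m \ge k$). The $m$-th jet scheme of $X$ is $X_m = \mathrm{Spec}\,R_m/\langle f^{(0)},\ldots,f^{(m)}\rangle \subseteq \mathbb{A}^{3(m+1)}$. For nonnegative integers $p,q,r$ put $L_{pqr} = L_{p,q,r} = \langle x_0,\ldots,x_{p-1},y_0,\ldots,y_{q-1},z_0,\ldots,z_{r-1}\rangle \subseteq R_m$. For $1 \leq l \leq n$ and $m \geq n$ put $I_m^l = L_{l,n+1-l,1} + \langle f^{(0)},\ldots,f^{(m)}\rangle$ and $Z_m^l = \mathbf{V}(I_m^l) \subseteq \mathbb{A}^{3(m+1)}$ (closed subvariety defined by the ideal). These are the irreducible components of the singular fiber $X_m^0 = \pi_m^{-1}(0)$, where $\pi_m : X_m \to X$ is the truncation morphism. For $1 \leq i < j \leq n$ put $I_m^{i,j} = \sqrt{I_m^i + I_m^j}$, so $\mathbf{V}(I_m^{i,j}) = Z_m^i \cap Z_m^j$. ''Irreducible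 decomposition'' means that the listed closed subsets are irreducible and none of them contains another. *)

(* Defs.v *)
From mathcomp Require Import all_boot all_order all_algebra.
From mathcomp Require Import boolp classical_sets reals.
From mathcomp Require Import complex.
From mathcomp Require Import mpoly.

Set Implicit Arguments.
Unset Strict Implicit.
Unset Printing Implicit Defensive.

Import GRing.Theory.
Local Open Scope ring_scope.
Local Open Scope classical_set_scope.
Local Open Scope complex_scope.

Section Ideals.
Variable A : comNzRingType.
Implicit Types (I J S P : set A).

(* Unlike [idealr_closed] of mathcomp, the whole ring is allowed. *)
Definition is_ideal I : Prop :=
  [/\ I 0, forall a b, I a -> I b -> I (a + b) & forall c a, I a -> I (c * a)].

Definition is_prime_ideal P : Prop :=
  [/\ is_ideal P, ~ P 1 & forall a b, P (a * b) -> P a \/ P b].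

Definition ideal_span S : set A := smallest is_ideal S.

Definition ideal_sum I J : set A :=
  [set c | exists a b, [/\ I a, J b & c = a + b]].

Definition radical I : set A := [set a | exists k : nat, I (a ^+ k)].

(* The points of Spec A are the prime ideals of A, and V(S) is the closed set
   of the Zariski topology defined by S. *)
Definition Spec : set (set A) := is_prime_ideal.

Definition V S : set (set A) := [set P | Spec P /\ S `<=` P].

Definition zariski_closed (Z : set (set A)) : Prop := exists S, Z = V S.

Definition irreducible (Z : set (set A)) : Prop :=
  Z !=set0 /\
  forall Z1 Z2, zariski_closed Z1 -> zariski_closed Z2 ->
    Z `<=` Z1 `|` Z2 -> Z `<=` Z1 \/ Z `<=` Z2.

Definition irreducible_decomposition (Z : set (set A)) (N : nat)
    (F : nat -> set (set A)) : Prop :=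
  [/\ Z = \bigcup_(u < N) F u,
      forall u, (u < N)%N -> zariski_closed (F u) /\ irreducible (F u) &
      forall u v, (u < N)%N -> (v < N)%N -> u <> v -> ~ (F u `<=` F v)].

End Ideals.

Section JetSchemes.
Variable R : realType.

(* f = x y - z^(n+1), the variables x, y, z having index 0, 1, 2. *)
Definition An_poly (n : nat) : {mpoly R[i][3]} :=
  'X_0 * 'X_1 - 'X_2%R ^+ n.+1.

Section Level.
Variable m : nat.

(* R_m; the indices of its variables are the pairs (c, k) of a coordinate c < 3
   and an order k <= m, encoded by [mxvec_index]. *)
Notation Rm := {mpoly R[i][3 * m.+1]}.

Definition jet_var (c : 'I_3) (k : 'I_m.+1) : Rm := 'X_(mxvec_index c k).

Definition generic_jet (c : 'I_3) : {poly Rm} :=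
  \sum_(k < m.+1) (jet_var c k)%:P * 'X^k.

(* f^(k), meaningful for k <= m only: the coefficient of t^k in f evaluated at
   the generic m-jet. *)
Definition jet_eq (n k : nat) : Rm :=
  (mmap (fun a : R[i] => (a%:MP : Rm)%:P) generic_jet (An_poly n))`_k.

Definition L (p q r : nat) : set Rm :=
  ideal_span [set v | exists k : 'I_m.+1,
    [\/ (k < p)%N /\ v = jet_var 0 k,
        (k < q)%N /\ v = jet_var 1 k |
        (k < r)%N /\ v = jet_var 2 k]].

(* The ideal generated by f^(a), ..., f^(m). *)
Definition jet_eqs_from (n a : nat) : set Rm :=
  ideal_span [set jet_eq n k | k in [set k : nat | (a <= k <= m)%N]].

Definition Icomp (n l : nat) : set Rm :=
  ideal_sum (L l (n + 1 - l) 1) (jet_eqs_from n 0).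

Definition Zcomp (n l : nat) : set (set Rm) := V (Icomp n l).

Definition Iinter (n i j : nat) : set Rm :=
  radical (ideal_sum (Icomp n i) (Icomp n j)).

End Level.
End JetSchemes.

Arguments L : clear implicits.
Arguments jet_eqs_from : clear implicits.
Arguments Icomp : clear implicits.
Arguments Zcomp : clear implicits.
Arguments Iinter : clear implicits.

(* Main.v *)
Require Import Defs.
From mathcomp Require Import all_boot all_order all_algebra.
From mathcomp Require Import boolp classical_sets reals.
From mathcomp Require Import complex.
From mathcomp Require Import mpoly.
From mathcomp Require Import ring zify.

(**
An m-jet is a triple of truncated series x(t), y(t), z(t). Modulo L_pqr it is
(t^p x', t^q y', t^r z'), and f becomes t^(p+q) x' y' - t^((n+1) r) z'^(n+1);
the lowest coefficients of this expression drive the whole proof ([jet_eq_low],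
[jet_eq_xy], [jet_eq_z]).

Minimal primes. By Krull's theorem the radical of I^i + I^j is the intersection
of the primes Q above it, so everything follows from a list of pairwise
incomparable primes one of which is contained in every such Q
([minimal_primes_decomposition]). Such a Q contains L_(j,n+1-i,1) and all f^(k).
Here p + q = n + 1 + (j - i) > n + 1, so that f^(n+1) reduces to -z_1^(n+1) and
z_1 lies in Q as soon as m > n ([prime_contains_z1]). If L_pq2 is contained in Q
and p + q < 2n + 2, then f^(p+q) reduces to x_p y_q, so Q contains x_p or y_q.
Hence p + q can be raised to min(m + 1, 2n + 2) ([prime_contains_L]); the
possible pairs (p, q) are those of the statement. When m < 2n + 2 all
the equations lie in L_pq2, which is prime. When m >= 2n + 2 the equations
f^(2n+2), ..., f^(m) remain, and modulo L_pq2 with p + q = 2n + 2 they are the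
equations of the jets of the same singularity in the series x', y', z'.

Primality. What is left is that jet schemes of an A_n singularity are integral
([jet_ideal_prime]). Let p + q = (n+1) r. Since f^(p+q+l) = x_p y_(q+l) + terms
with y_(q+l') for l' < l, inverting x_p allows one to solve the equations for
the y's; so L_pqr + (f^(p+q), ..., f^(k-1)) is the kernel of a homomorphism to a
field, hence prime, provided that x_p is a nonzerodivisor modulo this ideal
([jet_ideal_prime_of_nzd]). This proviso comes out of the following claim
([jet_eqs_regular]): if p + q <= (n+1) r, the sequence f^(p+q), ..., f^(m) is
regular modulo L_pqr. It is proved by decreasing induction on p + q.
 - If p + q < (n+1) r, the first term is x_p y_q modulo L_pqr. A sequence with
   first term a b is regular when those with first term a and b are
   ([regular_seqM]), and adding x_p or y_q to L_pqr gives L_(p+1,q,r) or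
   L_(p,q+1,r), to which the induction hypothesis applies.
 - If p + q = (n+1) r, modulo x_p the first term is -z_r^(n+1), and the case of
   L_(p+1,q,r+1) shows that x_p, f^(p+q), ..., f^(m) is regular. The head of a
   regular sequence is a nonzerodivisor modulo the ideal of the other terms
   ([regular_seq_swap]), which is the proviso. So all the ideals
   L_pqr + (f^(p+q), ..., f^(k-1)) are prime; they do not contain f^(k), and
   f^(p+q), ..., f^(m) is regular.
*)

Set Implicit Arguments.
Unset Strict Implicit.
Unset Printing Implicit Defensive.

Import GRing.Theory.
Local Open Scope ring_scope.
Local Open Scope classical_set_scope.

(** * Ideals *)

Lemma kernel_ideal (A B : comNzRingType) (phi : {rmorphism A -> B}) :
  is_ideal [set g | phi g = 0].
Proof.
split=> [|a b a0 b0|c a a0] /=; first exact: rmorph0.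
  by rewrite rmorphD /= a0 b0 addr0.
by rewrite rmorphM /= a0 mulr0.
Qed.

Section IdealTheory.
Variable A : comNzRingType.
Implicit Types (I J P Q S : set A) (a b c g : A).

Lemma ideal_mulr I a c : is_ideal I -> I a -> I (a * c).
Proof. by case=> _ _ IM Ia; rewrite mulrC; apply: IM. Qed.

Lemma ideal_opp I a : is_ideal I -> I a -> I (- a).
Proof. by case=> _ _ IM Ia; rewrite -mulN1r; apply: IM. Qed.

Lemma ideal_sub I a b : is_ideal I -> I a -> I b -> I (a - b).
Proof.
by move=> hI Ia Ib; case: (hI) => _ ID _; apply: ID => //; exact: ideal_opp.
Qed.

Lemma ideal_congr I a b : is_ideal I -> I (a - b) -> I b -> I a.
Proof. by case=> _ ID _ Iab Ib; rewrite -(subrK b a); apply: ID. Qed.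

Lemma ideal_bigsum I (T : Type) (r : seq T) (D : pred T) (F : T -> A) :
  is_ideal I -> (forall t, D t -> I (F t)) -> I (\sum_(t <- r | D t) F t).
Proof. by case=> I0 ID _ IF; elim/big_ind: _. Qed.

Lemma ideal_span_ideal S : is_ideal (ideal_span S).
Proof.
split=> [J [[]]//|a b Sa Sb J SJ|c a Sa J SJ].
- by have [[_ JD _] _] := SJ; apply: JD; [apply: Sa|apply: Sb].
- by have [[_ _ JM] _] := SJ; apply: JM; exact: Sa.
Qed.

Lemma sub_ideal_span S : S `<=` ideal_span S.
Proof. by move=> a Sa J [_]; apply. Qed.

Lemma ideal_span_min S J : is_ideal J -> S `<=` J -> ideal_span S `<=` J.
Proof. by move=> hJ SJ a; apply. Qed.

Lemma ideal_sum_ideal I J :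
  is_ideal I -> is_ideal J -> is_ideal (ideal_sum I J).
Proof.
move=> [I0 ID IM] [J0 JD JM]; split.
- by exists 0, 0; rewrite addr0.
- move=> _ _ [a [b [Ia Jb ->]]] [a' [b' [Ia' Jb' ->]]].
  by exists (a + a'), (b + b'); split; [exact: ID|exact: JD|ring].
- move=> c _ [a [b [Ia Jb ->]]].
  by exists (c * a), (c * b); split; [exact: IM|exact: JM|ring].
Qed.

Lemma ideal_sum_subP I J Q : is_ideal I -> is_ideal J -> is_ideal Q ->
  ideal_sum I J `<=` Q <-> I `<=` Q /\ J `<=` Q.
Proof.
move=> [I0 _ _] [J0 _ _] [_ QD _]; split=> [IJQ|[IQ JQ] _ [a [b [Ia Jb ->]]]].
  by split=> a ha; apply: IJQ;
    [exists a, 0; rewrite addr0|exists 0, a; rewrite add0r].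
by apply: QD; [exact: IQ|exact: JQ].
Qed.

(** The ideal I + (a). Adding one generator at a time, with an explicit
    coefficient, lets [foldl] build the ideals of the prefixes of a sequence. *)
Definition adjoin I a : set A := [set g | exists c, I (g - c * a)].

Lemma adjoin_ideal I a : is_ideal I -> is_ideal (adjoin I a).
Proof.
move=> [I0 ID IM]; split.
- by exists 0; rewrite mul0r subr0.
- move=> g h [c Ic] [d Id]; exists (c + d).
  by rewrite (_ : _ - _ = (g - c * a) + (h - d * a)); [exact: ID|ring].
- move=> c g [d Id]; exists (c * d).
  by rewrite (_ : _ - _ = c * (g - d * a)); [exact: IM|ring].
Qed.

Lemma sub_adjoin I a : I `<=` adjoin I a.
Proof. by move=> g Ig; exists 0; rewrite mul0r subr0. Qed.

Lemma adjoin_mem I a : is_ideal I -> adjoin I a a.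
Proof. by case=> I0 _ _; exists 1; rewrite mul1r subrr. Qed.

Lemma adjoin_min I a J : is_ideal J -> I `<=` J -> J a -> adjoin I a `<=` J.
Proof.
move=> hJ IJ Ja g [c /IJ Jc]; case: (hJ) => _ _ JM.
by apply: (ideal_congr hJ Jc); exact: JM.
Qed.

Lemma adjoinC I a b : adjoin (adjoin I a) b = adjoin (adjoin I b) a.
Proof.
have sub x y : adjoin (adjoin I x) y `<=` adjoin (adjoin I y) x.
  by move=> g [c [d Ig]]; exists d, c; rewrite addrAC.
by apply/seteqP; split; exact: sub.
Qed.

Lemma adjoin_congr I a b : is_ideal I -> I (a - b) -> adjoin I a = adjoin I b.
Proof.
move=> hI Iab.
have sub x y : I (x - y) -> adjoin I x `<=` adjoin I y.
  move=> Ixy; apply: adjoin_min; [exact: adjoin_ideal|exact: sub_adjoin|].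
  by exists 1; rewrite mul1r.
by apply/seteqP; split; apply: sub => //; rewrite -opprB; exact: ideal_opp.
Qed.

Lemma adjoinN I a : is_ideal I -> adjoin I (- a) = adjoin I a.
Proof.
move=> hI; apply/seteqP; split=> g [c Ic]; exists (- c).
  by rewrite mulNr -mulrN.
by rewrite mulrNN.
Qed.

Lemma foldl_adjoin_ideal I s : is_ideal I -> is_ideal (foldl adjoin I s).
Proof. by elim: s I => //= a s IHs I hI; exact/IHs/adjoin_ideal. Qed.

Lemma sub_foldl_adjoin I s : I `<=` foldl adjoin I s.
Proof.
elim: s I => [|a s IHs] I //=.
exact: subset_trans (@sub_adjoin I a) (IHs _).
Qed.

Lemma foldl_adjoin_mem I s a : is_ideal I -> a \in s -> foldl adjoin I s a.
Proof.
elim: s I => //= b s IHs I hI; rewrite inE => /orP[/eqP->|sa].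
  exact/sub_foldl_adjoin/adjoin_mem.
exact/IHs/sa/adjoin_ideal.
Qed.

Lemma foldl_adjoin_min I s J : is_ideal J -> I `<=` J ->
  {in s, forall a, J a} -> foldl adjoin I s `<=` J.
Proof.
move=> hJ; elim: s I => //= a s IHs I IJ sJ; apply: IHs.
  by apply: adjoin_min => //; apply: sJ; rewrite mem_head.
by move=> b sb; apply: sJ; rewrite inE sb orbT.
Qed.

Lemma ideal_sum_span I s : is_ideal I ->
  ideal_sum I (ideal_span [set` s]) = foldl adjoin I s.
Proof.
move=> hI; have hs := ideal_span_ideal [set` s].
apply/seteqP; split.
  apply/(ideal_sum_subP hI hs (foldl_adjoin_ideal s hI)); split.
    exact: sub_foldl_adjoin.
  apply: ideal_span_min; first exact: foldl_adjoin_ideal.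
  by move=> a /=; exact: foldl_adjoin_mem.
have hsum := ideal_sum_ideal hI hs.
have [Isum ssum] := (ideal_sum_subP hI hs hsum).1 (fun=> id).
apply: foldl_adjoin_min => // a sa; apply: ssum; exact: sub_ideal_span.
Qed.

(** * Prime ideals and irreducible closed sets *)

Lemma prime_expr P a k : is_prime_ideal P -> P (a ^+ k) -> P a.
Proof.
move=> [_ P1 PM]; elim: k => [/P1//|k IHk].
by rewrite exprS => /PM[].
Qed.

(** An ideal Q maximal among those that contain I and no power of a is prime: if
    it contains neither x nor y, then Q + (x) and Q + (y) contain powers of a,
    and the product of these lies in Q + (x y). Zorn's lemma is applied to the
    sets M for which I `|` M is such an ideal, so that the empty chain has an
    upper bound. *)
Lemma prime_ideal_avoiding I a : is_ideal I -> (forall k, ~ I (a ^+ k)) ->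
  exists Q, [/\ is_prime_ideal Q, I `<=` Q & ~ Q a].
Proof.
move=> hI Ia; case: (hI) => I0 ID IM.
pose T := [set J : set A | is_ideal (I `|` J) /\ forall k, ~ J (a ^+ k)].
have [F FT Fchain|M [[hM Ma] Mmax]] := @Zorn_bigcup A T.
  split=> [|k [J /FT[_ /(_ k)]]//].
  split; first by left.
    have Fin J x : F J -> (I `|` J) x -> (I `|` \bigcup_(X in F) X) x.
      by move=> FJ [|Jx]; [left|right; exists J].
    move=> x y [Ix|[J FJ Jx]] [Iy|[K FK Ky]].
    - by left; apply: ID.
    - have [[_ KD _] _] := FT _ FK.
      by apply: (Fin K) => //; apply: KD; [left|right].
    - have [[_ JD _] _] := FT _ FJ.
      by apply: (Fin J) => //; apply: JD; [right|left].
    - have [JK|KJ] := Fchain J K FJ FK.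
        have [[_ KD _] _] := FT _ FK.
        by apply: (Fin K) => //; apply: KD; right => //; exact: JK.
      have [[_ JD _] _] := FT _ FJ.
      by apply: (Fin J) => //; apply: JD; right => //; exact: KJ.
  move=> c x [Ix|[J FJ Jx]]; first by left; exact: IM.
  have [[_ _ JM] _] := FT _ FJ.
  by have [|Jcx] := JM c x (or_intror Jx); [left|right; exists J].
pose Q := I `|` M.
have Qa k : ~ Q (a ^+ k) by case=> [/Ia|/Ma].
have Qmax x : ~ Q x -> exists k c, Q (a ^+ k - c * x).
  move=> nQx; have hQx := adjoin_ideal x hM.
  have QQx := @sub_adjoin Q x.
  apply: contrapT => noexp; apply: (Mmax (adjoin Q x)).
    split=> [|/(_ x (adjoin_mem x hM)) Mx]; last by apply: nQx; right.
    by move=> y My; apply: QQx; right.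
  split=> [|k [c Qk]]; last by apply: noexp; exists k, c.
  suff -> : I `|` adjoin Q x = adjoin Q x by [].
  apply/seteqP; split=> [y [Iy|//]|y]; last by right.
  by apply: QQx; left.
exists Q; split; last 2 first.
- by move=> x Ix; left.
- by move=> Qa1; apply: (Qa 1%N); rewrite expr1.
split=> //; first by move=> Q1; apply: (Qa 0%N); rewrite expr0.
move=> x y Qxy; apply: contrapT => /not_orP[/Qmax[k [c Qk]] /Qmax[l [d Ql]]].
apply: (Qa (k + l)%N); rewrite exprD.
have [_ QD QM] := hM.
have -> : a ^+ k * a ^+ l = (a ^+ k - c * x) * a ^+ l
   + (c * x * (a ^+ l - d * y) + c * d * (x * y)) by ring.
by apply: (QD); [exact: ideal_mulr|apply: QD; exact: QM].
Qed.

Lemma radical_primeP I g : is_ideal I ->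
  radical I g <-> forall Q, is_prime_ideal Q -> I `<=` Q -> Q g.
Proof.
move=> hI; split=> [[k Ik] Q hQ IQ|Ig].
  by apply: (prime_expr hQ); exact: IQ Ik.
apply: contrapT => ng; have [k Ik|Q [hQ IQ]] := @prime_ideal_avoiding I g hI.
  by apply: ng; exists k.
by apply; exact: Ig.
Qed.

Lemma V_ideal_sum I J : is_ideal I -> is_ideal J ->
  V I `&` V J = V (ideal_sum I J).
Proof.
move=> hI hJ; apply/seteqP; split=> Q.
  move=> [[hQ IQ] [_ JQ]]; split=> //.
  by apply/ideal_sum_subP => //; case: hQ.
move=> [hQ]; have hQ' : is_ideal Q by case: hQ.
by move=> /(ideal_sum_subP hI hJ hQ')[IQ JQ].
Qed.

Lemma prime_irreducible P : is_prime_ideal P -> irreducible (V P).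
Proof.
move=> hP; have VP : V P P by split.
split; first by exists P.
move=> Z1 Z2 [S1 ->] [S2 ->] /(_ P VP)[] [_ SP]; [left|right];
  by move=> Q [hQ PQ]; split=> //; exact: subset_trans PQ.
Qed.

(** Finding finitely many incomparable primes above I, one of them below each
    prime above I, settles both the radical of I and the components of V(I). *)
Lemma minimal_primes_decomposition I (N : nat) (P : nat -> set A) :
  is_ideal I ->
  (forall u, (u < N)%N -> is_prime_ideal (P u) /\ I `<=` P u) ->
  (forall Q, is_prime_ideal Q -> I `<=` Q ->
     exists2 u, (u < N)%N & P u `<=` Q) ->
  (forall u v, (u < N)%N -> (v < N)%N -> u <> v -> ~ P u `<=` P v) ->
  radical I = \bigcap_(u < N) P u /\
  irreducible_decomposition (V I) N (fun u => V (P u)).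
Proof.
move=> hI hP Pmin Pinc; split.
  apply/seteqP; split=> g.
    by move=> /(radical_primeP g hI) Ig u /hP[hPu IPu]; exact: Ig.
  move=> Pg; apply/radical_primeP => // Q hQ /(Pmin Q hQ)[u uN PQ].
  by apply: PQ; exact: Pg.
split.
- apply/seteqP; split=> Q.
    move=> [hQ /(Pmin Q hQ)[u uN PQ]]; exists u => //.
  move=> [u /hP[hPu IPu] [hQ PQ]]; split=> //; exact: subset_trans PQ.
- move=> u /hP[hPu IPu]; split; last exact: prime_irreducible.
  by exists (P u).
- move=> u v uN vN uv VuVv; have [hPu _] := hP u uN.
  have [|_ PvPu] := VuVv (P u); first by split.
by apply: (Pinc v u vN uN) => // vu; apply: uv.
Qed.

End IdealTheory.

(** * Regular sequences *)

Section RegularSequences.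
Variable A : comNzRingType.
Implicit Types (I : set A) (a b : A) (s t : seq A).

Definition nzd_mod I a := forall g, I (a * g) -> I g.

(** Regularity in the weak sense: the last quotient may be zero. *)
Fixpoint regular_seq I s : Prop :=
  if s is a :: s' then nzd_mod I a /\ regular_seq (adjoin I a) s' else True.

Lemma regular_seq_cat I s t :
  regular_seq I (s ++ t) <->
  regular_seq I s /\ regular_seq (foldl (@adjoin A) I s) t.
Proof.
elim: s I => [|a s IHs] I /=; first by split=> [|[]].
by rewrite IHs; tauto.
Qed.

(** If a g = c b modulo I, then b kills c modulo I + (a), so c = d a modulo I,
    and a can be cancelled in a g = d a b. *)
Lemma nzd_mod_swap I a b : is_ideal I -> nzd_mod I a ->
  nzd_mod (adjoin I a) b -> nzd_mod (adjoin I b) a.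
Proof.
move=> hI Ia Iab g [c Ic]; have [d Id] : adjoin I a c.
  apply: Iab; exists g.
  by rewrite (_ : _ - _ = - (a * g - c * b)); [exact: ideal_opp|ring].
exists d; apply: Ia; have [_ ID IM] := hI.
rewrite (_ : _ * _ = (a * g - c * b) + b * (c - d * a)); last by ring.
by apply: ID => //; exact: IM.
Qed.

(** The head a moves to the end of the sequence by successive exchanges with its
    right neighbour; each exchange keeps a regular, by [nzd_mod_swap]. *)
Lemma regular_seq_swap I a s : is_ideal I -> regular_seq I (a :: s) ->
  nzd_mod (foldl (@adjoin A) I s) a.
Proof.
elim: s I => [|b s IHs] I hI /= [Ia]; first by [].
move=> [Iab reg]; apply: IHs; first exact: adjoin_ideal.
by split; [exact: nzd_mod_swap Iab|rewrite adjoinC].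
Qed.

Lemma nzd_modM I a b : nzd_mod I a -> nzd_mod I b -> nzd_mod I (a * b).
Proof. by move=> Ia Ib g; rewrite -mulrA => /Ia/Ib. Qed.

(** In the exact sequence A/(I + b) -> A/(I + ab) -> A/(I + a), where the first
    map is multiplication by a, an element regular on both ends is regular in
    the middle. Injectivity of the first map is the regularity of a modulo I. *)
Lemma nzd_mod_adjoinM I a b h : is_ideal I -> nzd_mod I a ->
  nzd_mod (adjoin I a) h -> nzd_mod (adjoin I b) h ->
  nzd_mod (adjoin I (a * b)) h.
Proof.
move=> hI Ia Iah Ibh g [c Ic]; have [_ ID IM] := hI.
have [v Iv] : adjoin I a g.
  by apply: Iah; exists (c * b); rewrite -mulrA (mulrC b).
have [d Id] : adjoin I b v.
  apply: Ibh; exists c; apply: Ia.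
  rewrite (_ : _ * _ = (h * g - c * (a * b)) - h * (g - v * a)); last by ring.
  by apply: ideal_sub => //; exact: IM.
exists d; rewrite (_ : _ - _ = (g - v * a) + a * (v - d * b)); last by ring.
by apply: ID => //; exact: IM.
Qed.

(** Modulo an initial part H of s, the element a is still regular by
    [nzd_mod_swap], so [nzd_mod_adjoinM] applies to the next term of s. *)
Lemma regular_seqM I a b s : is_ideal I -> regular_seq I (a :: s) ->
  regular_seq I (b :: s) -> regular_seq I (a * b :: s).
Proof.
elim: s I => [|h s IHs] I hI /=.
  by move=> [Ia _] [Ib _]; split=> //; exact: nzd_modM.
move=> [Ia [Iah rega]] [Ib [Ibh regb]].
split; first exact: nzd_modM.
split; first exact: nzd_mod_adjoinM.
rewrite adjoinC; have hIh := adjoin_ideal h hI.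
suff [] : regular_seq (adjoin I h) (a * b :: s) by [].
apply: IHs => //=; split; try by rewrite adjoinC.
- exact: nzd_mod_swap Iah.
- exact: nzd_mod_swap Ibh.
Qed.

Lemma regular_seqX I a s k : is_ideal I -> regular_seq I (a :: s) ->
  regular_seq I (a ^+ k.+1 :: s).
Proof.
move=> hI reg; elim: k => [|k IHk]; rewrite ?expr1 // exprS.
exact: regular_seqM.
Qed.

Lemma nzd_mod_congr I a b : is_ideal I -> I (a - b) -> nzd_mod I b ->
  nzd_mod I a.
Proof.
move=> hI Iab Ib g Iag; apply: Ib.
rewrite (_ : b * g = a * g - (a - b) * g); last by ring.
by apply: ideal_sub => //; exact: ideal_mulr.
Qed.

Lemma regular_seq_congr I a b s : is_ideal I -> I (a - b) ->
  regular_seq I (b :: s) -> regular_seq I (a :: s).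
Proof.
move=> hI Iab [Ib reg]; split; first exact: nzd_mod_congr Iab Ib.
by rewrite (adjoin_congr hI Iab).
Qed.

Lemma regular_seqN I a s : is_ideal I -> regular_seq I (a :: s) ->
  regular_seq I (- a :: s).
Proof.
move=> hI [Ia reg]; split; last by rewrite adjoinN.
by move=> g Ig; apply: Ia; rewrite -[a * g]opprK -mulNr; exact: ideal_opp.
Qed.

Lemma prime_nzd P a : is_prime_ideal P -> ~ P a -> nzd_mod P a.
Proof. by move=> [_ _ PM] Pa g /PM[]. Qed.

End RegularSequences.

(** * A primality criterion by elimination of variables *)

Section Elimination.
Variables (K : fieldType) (N : nat) (F : idomainType).
Notation A := {mpoly K[N]}.
Variables (phi iota : {rmorphism A -> F}) (I : set A) (s : A).
Hypotheses (hI : is_ideal I) (phiI : forall g, I g -> phi g = 0).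
Hypotheses (iota_inj : injective iota) (phis : phi s = iota s).
Hypotheses (phiC : forall c : K, phi c%:MP = iota c%:MP).

(** Modulo I and up to a power of s, the polynomial g can be written without the
    variables that [phi] eliminates. *)
Definition eliminable g := exists k h, I (s ^+ k * g - h) /\ phi h = iota h.

Lemma eliminableD g1 g2 :
  eliminable g1 -> eliminable g2 -> eliminable (g1 + g2).
Proof.
move=> [k1 [h1 [I1 e1]]] [k2 [h2 [I2 e2]]]; case: (hI) => _ ID IM.
exists (k1 + k2)%N, (s ^+ k2 * h1 + s ^+ k1 * h2); split; last first.
  by rewrite !rmorphD !rmorphM !rmorphXn /= phis e1 e2.
rewrite (_ : _ - _ =
  s ^+ k2 * (s ^+ k1 * g1 - h1) + s ^+ k1 * (s ^+ k2 * g2 - h2)).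
  by apply: ID; exact: IM.
by rewrite exprD; ring.
Qed.

Lemma eliminableM g1 g2 :
  eliminable g1 -> eliminable g2 -> eliminable (g1 * g2).
Proof.
move=> [k1 [h1 [I1 e1]]] [k2 [h2 [I2 e2]]]; case: (hI) => _ ID IM.
exists (k1 + k2)%N, (h1 * h2); split; last by rewrite !rmorphM /= e1 e2.
rewrite (_ : _ - _ =
  s ^+ k2 * g2 * (s ^+ k1 * g1 - h1) + h1 * (s ^+ k2 * g2 - h2)).
  by apply: ID; exact: IM.
by rewrite exprD; ring.
Qed.

Lemma eliminable_fix g : phi g = iota g -> eliminable g.
Proof.
by case: hI => I0 _ _ e; exists 0%N, g; rewrite expr0 mul1r subrr.
Qed.

Lemma eliminableN g : eliminable g -> eliminable (- g).
Proof.
rewrite -mulN1r; apply: eliminableM.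
by apply: eliminable_fix; rewrite !rmorphN1.
Qed.

Lemma eliminable_ideal g : I g -> eliminable g.
Proof.
by move=> Ig; exists 0%N, 0; rewrite expr0 mul1r subr0 !rmorph0.
Qed.

Lemma eliminable_solve g h : I (s * g - h) -> eliminable h -> eliminable g.
Proof.
case: (hI) => _ ID IM Ig [k [h' [Ih e]]]; exists k.+1, h'; split=> //.
rewrite (_ : _ - _ = s ^+ k * (s * g - h) + (s ^+ k * h - h')).
  by apply: ID => //; exact: IM.
by rewrite exprS; ring.
Qed.

Lemma eliminable_sum (T : Type) (r : seq T) (D : pred T) (G : T -> A) :
  (forall t, D t -> eliminable (G t)) -> eliminable (\sum_(t <- r | D t) G t).
Proof.
move=> elimG; elim/big_ind: _ => //; last exact: eliminableD.
by apply: eliminable_fix; rewrite !rmorph0.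
Qed.

Lemma eliminable_coefX (u : {poly A}) d :
  (forall k, eliminable u`_k) -> forall k, eliminable (u ^+ d)`_k.
Proof.
move=> elimu; elim: d => [|d IHd] k.
  by apply: eliminable_fix; rewrite expr0 coef1 !rmorph_nat.
by rewrite exprS coefM; apply: eliminable_sum => a _; exact: eliminableM.
Qed.

(** The ideal I is the kernel of [phi], which takes values in a domain: if
    phi(g) = 0 and s^k g = h modulo I with phi(h) = iota(h), then h = 0, and the
    factor s^k can be cancelled from s^k g. *)
Lemma prime_ideal_of_elimination : nzd_mod I s ->
  (forall v : 'I_N, eliminable 'X_v) -> is_prime_ideal I.
Proof.
move=> Is elimX.
have elim g : eliminable g.
  elim/mpolyind: g => [|c mon g _ _ IHg].
    by apply: eliminable_fix; rewrite !rmorph0.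
  apply: eliminableD => //; rewrite -mul_mpolyC; apply: eliminableM.
    exact/eliminable_fix/phiC.
  rewrite mpolyXE_id; elim/big_ind: _ => [||v _].
  - by apply: eliminable_fix; rewrite !rmorph1.
  - exact: eliminableM.
  - elim: (mon v) => [|d IHd].
      by apply: eliminable_fix; rewrite expr0 !rmorph1.
    by rewrite exprS; exact: eliminableM.
have kerI g : phi g = 0 -> I g.
  move=> g0; have [k [h [Ih eh]]] := elim g.
  have h0 : h = 0.
    apply: iota_inj; rewrite rmorph0 -eh.
    rewrite -[h](subKr (s ^+ k * g)) rmorphB rmorphM g0 mulr0.
    by rewrite (phiI Ih) subrr.
  rewrite h0 subr0 in Ih; elim: k Ih => [|k IHk]; first by rewrite mul1r.
  by rewrite exprS -mulrA => /Is.
split=> //.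
  by move=> /phiI/eqP; rewrite rmorph1 oner_eq0.
move=> a b /phiI/eqP; rewrite rmorphM mulf_eq0.
by move=> /orP[]/eqP /kerI; [left|right].
Qed.
End Elimination.

(** * Low-order coefficients of polynomials *)

Section LowOrderCoefficients.
Variable A : comNzRingType.
Implicit Types (p q u v w : {poly A}).

Lemma eq_coefM_low p p' q q' N :
  (forall k, (k < N)%N -> p`_k = p'`_k) ->
  (forall k, (k < N)%N -> q`_k = q'`_k) ->
  forall k, (k < N)%N -> (p * q)`_k = (p' * q')`_k.
Proof.
move=> pp' qq' k kN; rewrite !coefM; apply: eq_bigr => [[a /= ak]] _.
by rewrite pp' ?qq' //; lia.
Qed.

Lemma eq_coefX_low p p' N d :
  (forall k, (k < N)%N -> p`_k = p'`_k) ->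
  forall k, (k < N)%N -> (p ^+ d)`_k = (p' ^+ d)`_k.
Proof.
move=> pp'; elim: d => [|d IHd] k kN //; rewrite !exprS.
exact: eq_coefM_low kN.
Qed.

Lemma coefM_order (I : set A) p q a b : is_ideal I ->
  (forall k, (k < a)%N -> I p`_k) -> (forall k, (k < b)%N -> I q`_k) ->
  (forall k, (k < a + b)%N -> I (p * q)`_k) /\
  I ((p * q)`_(a + b) - p`_a * q`_b).
Proof.
move=> hI Ip Iq; have [_ _ IM] := hI.
split=> [k kab|]; rewrite coefM.
  apply: ideal_bigsum => // [[c /= ck]] _.
  case: (ltnP c a) => ca; first by apply: ideal_mulr => //; exact: Ip.
  by apply: IM; apply: Iq; lia.
have aab : (a < (a + b).+1)%N by lia.
rewrite (bigD1 (Ordinal aab)) //= addKn addrAC subrr add0r.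
apply: ideal_bigsum => // [[c /= cab]]; rewrite -val_eqE /= => ca.
case: (ltnP c a) => ca'; first by apply: ideal_mulr => //; exact: Ip.
by apply: IM; apply: Iq; lia.
Qed.

Lemma coefX_order (I : set A) p a d : is_ideal I ->
  (forall k, (k < a)%N -> I p`_k) ->
  (forall k, (k < d * a)%N -> I (p ^+ d)`_k) /\
  I ((p ^+ d)`_(d * a) - p`_a ^+ d).
Proof.
move=> hI Ip; have [I0 ID IM] := hI.
elim: d => [|d [IHlow IHtop]].
  by rewrite !mul0n; split=> //; rewrite !expr0 coef1 subrr.
rewrite mulSn !exprS; have [low top] := coefM_order hI Ip IHlow.
split=> //; rewrite (_ : _ - _ = ((p * p ^+ d)`_(a + d * a)
  - p`_a * (p ^+ d)`_(d * a)) + p`_a * ((p ^+ d)`_(d * a) - p`_a ^+ d)).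
  by apply: ID => //; exact: IM.
by ring.
Qed.

End LowOrderCoefficients.

Lemma divide_low (F : fieldType) (u w : {poly F}) d : u`_0 != 0 ->
  exists v : {poly F}, forall k, (k < d)%N -> (u * v)`_k = w`_k.
Proof.
move=> u0; elim: d => [|d [v uv]]; first by exists 0.
pose c := (w`_d - (u * v)`_d) / u`_0.
exists (v + c%:P * 'X^d) => k.
rewrite mulrDr mulrCA coefD coefCM coefMXn ltnS leq_eqVlt => /orP[/eqP->|kd].
  by rewrite ltnn subnn divfK // addrC subrK.
by rewrite kd mulr0 addr0 uv.
Qed.

(** * Equations of jets *)

Section Jets.
Variables (R : realType) (m : nat).
Notation K := R[i].
Notation Rm := {mpoly K[3 * m.+1]}.
Notation jet := (generic_jet R m).
Notation x := (jet 0).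
Notation y := (jet 1).
Notation z := (jet 2).
Implicit Types (p q r k n : nat).

Lemma coef_jet c (k : 'I_m.+1) : (jet c)`_k = jet_var R c k.
Proof.
rewrite /generic_jet coef_sum (bigD1 k) //= coefCM coefXn eqxx mulr1.
rewrite big1 ?addr0 // => a ak; rewrite coefCM coefXn.
by rewrite eq_sym val_eqE (negPf ak) mulr0.
Qed.

Lemma coef_jet_large c k : (m < k)%N -> (jet c)`_k = 0.
Proof.
move=> mk; rewrite /generic_jet coef_sum big1 // => a _; rewrite coefCM coefXn.
by rewrite gtn_eqF ?mulr0 //; case: a => a /= am; lia.
Qed.

Lemma jet_eqE n k : jet_eq R m n k = (x * y - z ^+ n.+1)`_k.
Proof.
rewrite /jet_eq /An_poly.
rewrite -[mmap _ _ _]/(mmap (polyC \o @mpolyC (3 * m.+1) K) _ _).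
by rewrite rmorphB rmorphM rmorphXn /= !mmapX !mmap1U.
Qed.

(** The generators may be taken with arbitrary indices, because the coefficients
    of the generic jets vanish beyond order m. *)
Lemma L_subP p q r (J : set Rm) : is_ideal J ->
  L R m p q r `<=` J <->
  [/\ forall k, (k < p)%N -> J x`_k, forall k, (k < q)%N -> J y`_k
    & forall k, (k < r)%N -> J z`_k].
Proof.
move=> hJ; have J0 : J 0 by case: hJ.
split=> [LJ|[Jx Jy Jz]].
  split=> k kp; (case: (ltnP m k) => mk; first by rewrite coef_jet_large);
    rewrite -[k]/(val (Ordinal (mk : (k < m.+1)%N))) coef_jet;
    apply: LJ; apply: sub_ideal_span; exists (Ordinal (mk : (k < m.+1)%N)).
  - by constructor 1.
  - by constructor 2.
  - by constructor 3.
apply: ideal_span_min => // _ [k [] [kp ->]]; rewrite -coef_jet.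
- exact: Jx.
- exact: Jy.
- exact: Jz.
Qed.

Lemma L_ideal p q r : is_ideal (L R m p q r).
Proof. exact: ideal_span_ideal. Qed.

Lemma L_mem p q r :
  [/\ forall k, (k < p)%N -> L R m p q r x`_k,
      forall k, (k < q)%N -> L R m p q r y`_k
    & forall k, (k < r)%N -> L R m p q r z`_k].
Proof. by apply/L_subP => //; exact: L_ideal. Qed.

Lemma L_subset p q r p' q' r' : (p <= p')%N -> (q <= q')%N -> (r <= r')%N ->
  L R m p q r `<=` L R m p' q' r'.
Proof.
move=> pp' qq' rr'; have [Lx Ly Lz] := L_mem p' q' r'.
apply/L_subP; first exact: L_ideal.
by split=> k kp; [apply: Lx|apply: Ly|apply: Lz]; lia.
Qed.

Lemma adjoin_L p q r :
  [/\ adjoin (L R m p q r) x`_p = L R m p.+1 q r,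
      adjoin (L R m p q r) y`_q = L R m p q.+1 r
    & adjoin (L R m p q r) z`_r = L R m p q r.+1].
Proof.
have step p' q' r' a : L R m p q r `<=` L R m p' q' r' -> L R m p' q' r' a ->
    (forall J : set Rm, is_ideal J -> L R m p q r `<=` J -> J a ->
       L R m p' q' r' `<=` J) ->
    adjoin (L R m p q r) a = L R m p' q' r'.
  move=> LL La Lmin; have hL := L_ideal p q r; apply/seteqP; split.
    by apply: adjoin_min => //; exact: L_ideal.
  apply: Lmin; [exact: adjoin_ideal|exact: sub_adjoin|exact: adjoin_mem].
split; apply: step; try exact: L_subset.
- by have [Lx _ _] := L_mem p.+1 q r; exact: Lx.
- move=> J hJ /(L_subP p q r hJ)[Jx Jy Jz] Jp; apply/L_subP => //; split=> // k.
  by rewrite ltnS leq_eqVlt => /orP[/eqP->|kp]; last exact: Jx.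
- by have [_ Ly _] := L_mem p q.+1 r; exact: Ly.
- move=> J hJ /(L_subP p q r hJ)[Jx Jy Jz] Jp; apply/L_subP => //; split=> // k.
  by rewrite ltnS leq_eqVlt => /orP[/eqP->|kp]; last exact: Jy.
- by have [_ _ Lz] := L_mem p q r.+1; exact: Lz.
- move=> J hJ /(L_subP p q r hJ)[Jx Jy Jz] Jp; apply/L_subP => //; split=> // k.
  by rewrite ltnS leq_eqVlt => /orP[/eqP->|kp]; last exact: Jz.
Qed.

(** Modulo L_pqr the polynomial f at the generic jet is
    t^(p+q) x' y' - t^((n+1) r) z'^(n+1). The order of this series is at least
    the smaller of the two exponents, and [jet_eq_xy] and [jet_eq_z] give its
    coefficient there when the exponents differ. *)
Lemma jet_eq_low n p q r I k : is_ideal I -> L R m p q r `<=` I ->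
  (k < p + q)%N -> (k < n.+1 * r)%N -> I (jet_eq R m n k).
Proof.
move=> hI /(L_subP p q r hI)[Ix Iy Iz] kpq knr.
have [xy _] := coefM_order hI Ix Iy; have [zn _] := coefX_order n.+1 hI Iz.
by rewrite jet_eqE coefB; apply: ideal_sub => //; [exact: xy|exact: zn].
Qed.

Lemma jet_eq_xy n p q r I : is_ideal I -> L R m p q r `<=` I ->
  (p + q < n.+1 * r)%N -> I (jet_eq R m n (p + q) - x`_p * y`_q).
Proof.
move=> hI /(L_subP p q r hI)[Ix Iy Iz] pqr.
have [_ xy] := coefM_order hI Ix Iy; have [zn _] := coefX_order n.+1 hI Iz.
by rewrite jet_eqE coefB addrAC; apply: ideal_sub => //; exact: zn.
Qed.

Lemma jet_eq_z n p q r I : is_ideal I -> L R m p q r `<=` I ->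
  (n.+1 * r < p + q)%N -> I (jet_eq R m n (n.+1 * r) - - z`_r ^+ n.+1).
Proof.
move=> hI /(L_subP p q r hI)[Ix Iy Iz] pqr.
have [xy _] := coefM_order hI Ix Iy; have [_ zn] := coefX_order n.+1 hI Iz.
rewrite jet_eqE coefB -addrA -opprD; apply: ideal_sub => //; exact: xy.
Qed.

(** * Jets with values in a ring *)

Section Evaluation.
Variables (S : comNzRingType) (kappa : {rmorphism K -> S}).
Variable w : 'I_3 -> {poly S}.

(** The jet with values in S whose coordinates are the truncations of the series
    [w c] at order m, seen as a homomorphism from the ring of the jet space. *)
Definition jet_eval : {rmorphism Rm -> S} :=
  mmap kappa (fun v => mxvec (\matrix_(c < 3, k < m.+1) (w c)`_k) 0 v).

Lemma jet_evalC c : jet_eval c%:MP = kappa c.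
Proof. exact: mmapC. Qed.

Lemma jet_eval_coef c k : (k <= m)%N -> jet_eval (jet c)`_k = (w c)`_k.
Proof.
move=> km; rewrite -[k]/(val (Ordinal (km : (k < m.+1)%N))) coef_jet.
by rewrite /jet_var /= mmapX mmap1U mxvecE mxE.
Qed.

Lemma jet_eval_eq n k : (k <= m)%N ->
  jet_eval (jet_eq R m n k) = (w 0 * w 1 - w 2 ^+ n.+1)`_k.
Proof.
move=> km; rewrite jet_eqE -coef_map rmorphB rmorphM rmorphXn /= !coefB.
have low c a : (a < m.+1)%N -> (map_poly jet_eval (jet c))`_a = (w c)`_a.
  by move=> am; rewrite coef_map; exact: jet_eval_coef.
rewrite (eq_coefM_low (low 0) (low 1)) //.
by rewrite (eq_coefX_low _ (low 2)).
Qed.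

End Evaluation.

Lemma jet_cases (P : Rm -> Prop) :
  (forall k, (k <= m)%N -> [/\ P x`_k, P y`_k & P z`_k]) ->
  forall v : 'I_(3 * m.+1), P 'X_v.
Proof.
move=> Pxyz v; case/mxvec_indexP: v => c k.
rewrite -/(jet_var R c k) -coef_jet.
have ord3 : [\/ c = 0, c = 1 | c = 2].
  by case: c => -[|[|[|//]]] clt; [constructor 1|constructor 2|constructor 3];
    exact: val_inj.
by have := Pxyz k (ltn_ord k); case: ord3 => -> [].
Qed.

Definition triple (T : Type) (a b c : T) (i : 'I_3) : T :=
  if i == 0 then a else if i == 1 then b else c.

Lemma jet_eval_L (S : comNzRingType) (kappa : {rmorphism K -> S})
    (w : 'I_3 -> {poly S}) p q r :
  (forall k, (k < p)%N -> (w 0)`_k = 0) ->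
  (forall k, (k < q)%N -> (w 1)`_k = 0) ->
  (forall k, (k < r)%N -> (w 2)`_k = 0) ->
  L R m p q r `<=` [set g | jet_eval kappa w g = 0].
Proof.
move=> wx wy wz.
have coef0 c k : (w c)`_k = 0 -> jet_eval kappa w (jet c)`_k = 0.
  move=> w0; case: (ltnP m k) => km; first by rewrite coef_jet_large // rmorph0.
  by rewrite jet_eval_coef.
apply/L_subP; first exact: kernel_ideal.
by split=> k kp; apply: coef0; [exact: wx|exact: wy|exact: wz].
Qed.

(** Setting the generating variables to zero is an endomorphism of the
    polynomial ring that fixes the other variables; its kernel is L_pqr. *)
Lemma L_prime p q r : is_prime_ideal (L R m p q r).
Proof.
pose w := triple (drop_poly p x * 'X^p) (drop_poly q y * 'X^q)
  (drop_poly r z * 'X^r).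
pose phi := jet_eval (@mpolyC (3 * m.+1) K) w.
have [Lx Ly Lz] := L_mem p q r.
have dropE (u : {poly Rm}) b k :
    (drop_poly b u * 'X^b)`_k = if (k < b)%N then 0 else u`_k.
  by rewrite coefMXn coef_drop_poly; case: ltnP => // /subnK->.
have phiE c k : (k <= m)%N -> phi (jet c)`_k = (w c)`_k by exact: jet_eval_coef.
have L0 : L R m p q r 0 by case: (L_ideal p q r).
apply: (@prime_ideal_of_elimination _ _ _ phi idfun _ 1) => //.
- exact: L_ideal.
- by apply: jet_eval_L => k kp; rewrite /w dropE kp.
- exact: rmorph1.
- by move=> c; exact: jet_evalC.
- by move=> g; rewrite mul1r.
pose elim := eliminable phi idfun (L R m p q r) 1.
apply: (@jet_cases elim) => k km.
suff elimc c b : (forall k, (k < b)%N -> L R m p q r (jet c)`_k) ->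
    phi (jet c)`_k = (drop_poly b (jet c) * 'X^b)`_k ->
    elim (jet c)`_k.
  by split; [apply: (elimc _ p)|apply: (elimc _ q)|apply: (elimc _ r)] => //;
    exact: phiE.
rewrite dropE => Lc; case: ltnP => kb phik.
  by exists 0%N, 0; rewrite rmorph0 expr0 mul1r subr0; split=> //; exact: Lc.
by exists 0%N, (jet c)`_k; rewrite expr0 mul1r subrr.
Qed.

(** The jet (t^a, t^b, t^c), used to show that an ideal does not contain a given
    element. An exponent larger than m makes the coordinate zero. *)
Definition monomial_arc (a b c : nat) : {rmorphism Rm -> K} :=
  jet_eval idfun (triple 'X^a 'X^b 'X^c).

Lemma monomial_arc_coef a b c k : (k <= m)%N ->
  [/\ monomial_arc a b c x`_k = (k == a)%:R,
      monomial_arc a b c y`_k = (k == b)%:R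
    & monomial_arc a b c z`_k = (k == c)%:R].
Proof.
by move=> km; split; rewrite /monomial_arc jet_eval_coef // coefXn.
Qed.

Lemma monomial_arc_eq n a b c k : (k <= m)%N ->
  monomial_arc a b c (jet_eq R m n k) = (k == a + b)%:R - (k == n.+1 * c)%:R.
Proof.
move=> km; rewrite /monomial_arc jet_eval_eq // /triple /=.
by rewrite -exprD -exprM coefB !coefXn (mulnC c).
Qed.

Lemma monomial_arc_L a b c p q r : (p <= a)%N -> (q <= b)%N -> (r <= c)%N ->
  L R m p q r `<=` [set g | monomial_arc a b c g = 0].
Proof.
by move=> pa qb rc; apply: jet_eval_L => k kp; rewrite coefXn ltn_eqF //; lia.
Qed.

(** The jet (t^p, t^q, t^r) is a point of V(L_pqr) where these three coordinates
    are equal to 1. *)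
Lemma L_nzd p q r :
  [/\ (p <= m)%N -> nzd_mod (L R m p q r) x`_p,
      (q <= m)%N -> nzd_mod (L R m p q r) y`_q
    & (r <= m)%N -> nzd_mod (L R m p q r) z`_r].
Proof.
have arc0 := @monomial_arc_L p q r p q r (leqnn _) (leqnn _) (leqnn _).
split=> km; apply: prime_nzd (L_prime p q r) _ => /arc0;
  have [arcx arcy arcz] := monomial_arc_coef p q r km; move/eqP.
- by rewrite arcx eqxx oner_eq0.
- by rewrite arcy eqxx oner_eq0.
- by rewrite arcz eqxx oner_eq0.
Qed.

(** * Integrality of the jet schemes *)

Definition jet_eqs n a b : seq Rm := [seq jet_eq R m n k | k <- index_iota a b].

(** For p + q = (n+1) r these are the equations, up to order k - 1 - (p + q), of
    the jets of the same singularity in the series x / t^p, y / t^q, z / t^r. *)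
Definition jet_ideal n p q r k : set Rm :=
  foldl (@adjoin Rm) (L R m p q r) (jet_eqs n (p + q) k).

Lemma jet_ideal_ideal n p q r k : is_ideal (jet_ideal n p q r k).
Proof. exact/foldl_adjoin_ideal/L_ideal. Qed.

Lemma jet_ideal_subP n p q r k J : is_ideal J ->
  L R m p q r `<=` J ->
  (forall l, (p + q <= l < k)%N -> J (jet_eq R m n l)) ->
  jet_ideal n p q r k `<=` J.
Proof.
move=> hJ LJ fJ; apply: foldl_adjoin_min => // _ /mapP[l lk ->].
by apply: fJ; rewrite mem_index_iota in lk.
Qed.

Lemma jet_ideal_mem n p q r k l : (p + q <= l < k)%N ->
  jet_ideal n p q r k (jet_eq R m n l).
Proof.
move=> pql; apply: foldl_adjoin_mem; first exact: L_ideal.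
by apply: map_f; rewrite mem_index_iota.
Qed.

Lemma sub_jet_ideal n p q r k : L R m p q r `<=` jet_ideal n p q r k.
Proof. exact: sub_foldl_adjoin. Qed.

(* a lower bound a + b for the order *)
Lemma monomial_arc_jet_ideal n a b c p q r k : (k <= m.+1)%N ->
  (p <= a)%N -> (q <= b)%N -> (r <= c)%N ->
  (k <= a + b)%N -> (k <= n.+1 * c)%N ->
  jet_ideal n p q r k `<=` [set g | monomial_arc a b c g = 0].
Proof.
move=> km pa qb rc kab kc; apply: jet_ideal_subP.
- exact: kernel_ideal.
- exact: monomial_arc_L.
move=> l /andP[_ lk] /=; rewrite monomial_arc_eq; last by lia.
by rewrite !ltn_eqF ?subrr //; lia.
Qed.

(** Write d = k - (p + q). Over the fraction field, x / t^p is an invertible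
    series, so the first d coefficients of y / t^q are determined by
    y / t^q = (z / t^r)^(n+1) / (x / t^p). This gives a homomorphism [phi] which
    vanishes on the ideal and fixes the remaining variables. Conversely, each
    equation expresses x_p y_b modulo the ideal by variables already treated,
    so the y_b are eliminated one after the other, at the cost of powers
    of x_p. *)
Lemma jet_ideal_prime_of_nzd n p q r k : (p + q = n.+1 * r)%N -> (p <= m)%N ->
  (p + q <= k <= m.+1)%N -> nzd_mod (jet_ideal n p q r k) x`_p ->
  is_prime_ideal (jet_ideal n p q r k).
Proof.
move=> pqr pm /andP[pqk km] xp_nzd; set d := (k - (p + q))%N.
pose F : fieldType := {fraction Rm}.
pose iota : {rmorphism Rm -> F} := @tofrac Rm.
have iota_inj : injective iota by move=> a b /eqP; rewrite tofrac_eq => /eqP.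
pose x' : {poly F} := map_poly iota (drop_poly p x).
pose z' : {poly F} := map_poly iota (drop_poly r z).
have x'0 : x'`_0 != 0.
  rewrite coef_map coef_drop_poly add0n -(rmorph0 iota) (inj_eq iota_inj).
  apply/negP => /eqP xp0; have [/(_ pm) xL _ _] := L_nzd p q r.
  have [_ /(_ _) L1 _] := L_prime p q r; apply: L1; apply: xL.
  by rewrite xp0 mul0r; case: (L_ideal p q r).
(* x' v = z'^(n+1) mod t^d; beyond order d the coefficients of y' stay free *)
have [v xv] := divide_low (z' ^+ n.+1) d x'0.
pose y' : {poly F} :=
  \poly_(l < m.+1) (if (l < d)%N then v`_l else iota y`_(q + l)).
pose w : 'I_3 -> {poly F} := triple (x' * 'X^p) (y' * 'X^q) (z' * 'X^r).
pose phi := jet_eval (iota \o @mpolyC (3 * m.+1) K) w.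
have shiftE (u : {poly F}) b a :
    (u * 'X^b)`_a = if (a < b)%N then 0 else u`_(a - b).
  exact: coefMXn.
have phix a : (p <= a <= m)%N -> phi x`_a = iota x`_a.
  move=> /andP[pa am]; rewrite /phi jet_eval_coef // shiftE ltnNge pa /=.
  by rewrite coef_map coef_drop_poly subnK.
have phiz a : (r <= a <= m)%N -> phi z`_a = iota z`_a.
  move=> /andP[pa am]; rewrite /phi jet_eval_coef // shiftE ltnNge pa /=.
  by rewrite coef_map coef_drop_poly subnK.
have phiy a : (q + d <= a <= m)%N -> phi y`_a = iota y`_a.
  move=> /andP[qa am]; rewrite /phi jet_eval_coef // shiftE.
  rewrite ltnNge (leq_trans (leq_addr _ _) qa) /= coef_poly.
  have [-> ->] : (a - q < m.+1)%N /\ (a - q < d)%N = false by lia.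
  by rewrite subnKC //; lia.
have phiI : jet_ideal n p q r k `<=` [set g | phi g = 0].
  apply: jet_ideal_subP; first exact: kernel_ideal.
    by apply: jet_eval_L => a ac; rewrite /w shiftE ac.
  move=> l /andP[pql lk] /=; rewrite /phi jet_eval_eq; last by lia.
  rewrite /w /triple /= mulrACA -exprD exprMn -exprM (mulnC r) -pqr -mulrBl.
  rewrite shiftE ltnNge pql /= coefB -xv; last by rewrite /d; lia.
  apply/eqP; rewrite subr_eq0; apply/eqP.
  apply: (@eq_coefM_low _ _ _ _ _ d) => // [a ad|]; last by rewrite /d; lia.
  by rewrite coef_poly ad; case: ifP => //; lia.
pose elim := eliminable phi iota (jet_ideal n p q r k) x`_p.
have hI := jet_ideal_ideal n p q r k.
have phis : phi x`_p = iota x`_p by apply: phix; rewrite leqnn pm.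
have elim0 c a : (m < a)%N -> elim (jet c)`_a.
  move=> am; rewrite coef_jet_large //.
  by apply: eliminable_fix; rewrite ?rmorph0.
have [Ix Iy Iz] := (L_subP p q r hI).1 (@sub_jet_ideal n p q r k).
have elimx a : elim x`_a.
  case: (ltnP m a) => am; first exact: elim0.
  case: (ltnP a p) => ap; first exact/eliminable_ideal/Ix.
  by apply: eliminable_fix => //; rewrite phix // ap am.
have elimz a : elim z`_a.
  case: (ltnP m a) => am; first exact: elim0.
  case: (ltnP a r) => ar; first exact/eliminable_ideal/Iz.
  by apply: eliminable_fix => //; rewrite phiz // ar am.
have elimy a : elim y`_a.
  elim/ltn_ind: a => b IHb.
  case: (ltnP m b) => bm; first exact: elim0.
  case: (ltnP b q) => bq; first exact/eliminable_ideal/Iy.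
  case: (leqP (q + d) b) => qb.
    by apply: eliminable_fix => //; rewrite phiy // qb bm.
  have Ieq : jet_ideal n p q r k (jet_eq R m n (p + b)).
    by apply: jet_ideal_mem; rewrite /d in qb; lia.
  (* f^(p+b) = x_p y_b + terms in the x_a, the z_a and the y_a with a < b *)
  pose h := x`_p * y`_b - jet_eq R m n (p + b).
  apply: (@eliminable_solve _ _ _ _ _ _ _ hI _ h).
    by rewrite subKr.
  rewrite /h jet_eqE coefB opprB addrCA; apply: eliminableD => //.
    exact: eliminable_coefX.
  have ppb : (p < (p + b).+1)%N by lia.
  rewrite coefM (bigD1 (Ordinal ppb)) //= addKn opprD addNKr.
  apply: eliminableN => //; apply: eliminable_sum => // [[a /= ab]].
  rewrite -val_eqE /= => ap.
  case: (ltnP a p) => ap'.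
    by apply: eliminable_ideal => //; apply: ideal_mulr => //; exact: Ix.
  apply: eliminableM; [exact: hI|exact: elimx|apply: IHb; lia].
apply: (prime_ideal_of_elimination hI phiI iota_inj phis _ xp_nzd).
  by move=> c; exact: jet_evalC.
apply: (@jet_cases elim) => a _.
by split; [exact: elimx|exact: elimy|exact: elimz].
Qed.

Lemma jet_eqs_cat n a b c : (a <= b <= c)%N ->
  jet_eqs n a c = jet_eqs n a b ++ jet_eqs n b c.
Proof.
move=> /andP[ab bc]; rewrite /jet_eqs -map_cat /index_iota.
by rewrite (_ : (c - a)%N = ((b - a) + (c - b))%N) ?iotaD ?subnKC //; lia.
Qed.

Lemma jet_ideal_prime_of_regular n p q r k : (p + q = n.+1 * r)%N ->
  (p + q <= k <= m.+1)%N -> (p <= m)%N ->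
  regular_seq (L R m p q r) (x`_p :: jet_eqs n (p + q) m.+1) ->
  is_prime_ideal (jet_ideal n p q r k).
Proof.
move=> pqr pqk pm reg; apply: jet_ideal_prime_of_nzd => //.
apply: regular_seq_swap; first exact: L_ideal.
move: reg; rewrite (jet_eqs_cat n pqk) -cat_cons.
by move=> /regular_seq_cat[].
Qed.

(** The ideals generated by initial parts of the sequence are prime, so it is
    enough that none of them contains the next equation. *)
Lemma jet_eqs_regular_of_cons n p q r : (p + q = n.+1 * r)%N -> (p <= m)%N ->
  regular_seq (L R m p q r) (x`_p :: jet_eqs n (p + q) m.+1) ->
  regular_seq (L R m p q r) (jet_eqs n (p + q) m.+1).
Proof.
move=> pqr pm reg.
suff regk k : (p + q <= k <= m.+1)%N ->
    regular_seq (L R m p q r) (jet_eqs n (p + q) k).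
  case: (leqP (p + q) m.+1) => pqm; first by apply: regk; rewrite pqm leqnn.
  rewrite /jet_eqs /index_iota (_ : (m.+1 - (p + q))%N = 0%N) //; lia.
elim: k => [|k IHk] /andP[pqk km].
  by rewrite /jet_eqs /index_iota sub0n.
case: (ltnP k (p + q)) => kpq.
  by rewrite (_ : (p + q)%N = k.+1) ?/jet_eqs ?/index_iota ?subnn //; lia.
have pqk' : (p + q <= k <= k.+1)%N by rewrite kpq leqnSn.
rewrite (jet_eqs_cat n pqk'); apply/regular_seq_cat; split.
  by apply: IHk; rewrite kpq ltnW.
rewrite /jet_eqs /index_iota subSnn /=; split=> //.
apply: prime_nzd.
  by apply: (jet_ideal_prime_of_regular pqr) => //; rewrite kpq ltnW.
(* on the jet x = t^p, y = t^(k-p), z = 0 the ideal vanishes and f^(k) is 1 *)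
pose c := (r + m.+1)%N.
have arcJ : jet_ideal n p q r k `<=`
    [set g | monomial_arc p (k - p) c g = 0].
  by apply: monomial_arc_jet_ideal; rewrite /c; nia.
move=> /arcJ /eqP; rewrite monomial_arc_eq //.
have [-> ->] : (k == p + (k - p))%N /\ (k == n.+1 * c)%N = false.
  by rewrite /c; split; nia.
by rewrite subr0 oner_eq0.
Qed.

(** Modulo x_p the first equation is -z_r^(n+1). Replacing it by z_r, as
    [regular_seqX] allows, leads to L_(p+1,q,r+1), where the number of
    remaining equations has dropped. *)
Lemma jet_eqs_regular_cons n p q r :
  (forall p' q' r', (p' + q' = (p + q).+1)%N -> (p' + q' <= n.+1 * r')%N ->
     regular_seq (L R m p' q' r') (jet_eqs n (p' + q') m.+1)) ->
  (p + q = n.+1 * r)%N -> (p + q <= m)%N ->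
  regular_seq (L R m p q r) (x`_p :: jet_eqs n (p + q) m.+1).
Proof.
move=> IH pqr pqm; have [Lx _ _] := L_nzd p q r.
have [adjx _ _] := adjoin_L p q r.
have [_ _ adjz] := adjoin_L p.+1 q r.
have [_ _ Lz] := L_nzd p.+1 q r.
have hL := L_ideal p.+1 q r.
rewrite /= adjx; split; first by apply: Lx; lia.
have [eqs_cons pq1] : jet_eqs n (p + q) m.+1 =
    jet_eq R m n (p + q) :: jet_eqs n (p.+1 + q) m.+1 /\
    (p.+1 + q <= n.+1 * r.+1)%N.
  split; last by lia.
  by rewrite /jet_eqs /index_iota subSn // addSn subSS.
rewrite eqs_cons; apply: (@regular_seq_congr _ _ _ (- z`_r ^+ n.+1)) => //.
  have := @jet_eq_z n p.+1 q r _ hL (@subset_refl _ _).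
  by rewrite -pqr; apply; lia.
apply: regular_seqN => //; apply: regular_seqX => //=; rewrite adjz; split.
  by apply: Lz; nia.
exact: IH.
Qed.

(** Decreasing induction on p + q, for all r at once: regularity modulo L_pqr
    follows from regularity modulo L_(p+1,q,r) and L_(p,q+1,r) if
    p + q < (n+1) r, and modulo L_(p+1,q,r+1) if p + q = (n+1) r. *)
Lemma jet_eqs_regular n p q r : (p + q <= n.+1 * r)%N ->
  regular_seq (L R m p q r) (jet_eqs n (p + q) m.+1).
Proof.
have [d] := ubnP (m.+1 - (p + q)); elim: d p q r => // d IHd p q r pqd pqr.
case: (ltnP m (p + q)) => pqm.
  by rewrite /jet_eqs /index_iota (_ : (m.+1 - (p + q))%N = 0%N) //; lia.
have IH p' q' r' : (p' + q' = (p + q).+1)%N -> (p' + q' <= n.+1 * r')%N ->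
    regular_seq (L R m p' q' r') (jet_eqs n (p' + q') m.+1).
  by move=> pq' pqr'; apply: IHd => //; lia.
move: pqr; rewrite leq_eqVlt => /orP[/eqP pqr|pqr].
  apply: jet_eqs_regular_of_cons => //; first by lia.
  exact: jet_eqs_regular_cons.
have hL := L_ideal p q r; have [Lx Ly _] := L_nzd p q r.
have [adjx adjy _] := adjoin_L p q r.
have -> : jet_eqs n (p + q) m.+1 =
    jet_eq R m n (p + q) :: jet_eqs n (p + q).+1 m.+1.
  by rewrite /jet_eqs /index_iota subSn // subSS.
apply: (@regular_seq_congr _ _ _ (x`_p * y`_q)) => //.
  exact: (@jet_eq_xy n p q r).
apply: regular_seqM => //=; rewrite ?adjx ?adjy; split.
- by apply: Lx; lia.
- by rewrite -addSn; apply: IH; lia.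
- by apply: Ly; lia.
- by rewrite -addnS; apply: IH; lia.
Qed.

(** Integrality of the jet schemes of the A_n singularity. *)
Lemma jet_ideal_prime n p q r : (p + q = n.+1 * r)%N -> (p + q <= m)%N ->
  is_prime_ideal (jet_ideal n p q r m.+1).
Proof.
move=> pqr pqm; apply: (jet_ideal_prime_of_regular pqr).
- by rewrite leqnn andbT ltnW.
- by lia.
apply: jet_eqs_regular_cons => // p' q' r' _; exact: jet_eqs_regular.
Qed.

Lemma ideal_sum_jet_eqs_from n p q r a : a = (p + q)%N ->
  ideal_sum (L R m p q r) (jet_eqs_from R m n a) = jet_ideal n p q r m.+1.
Proof.
move=> ->; rewrite /jet_ideal -ideal_sum_span; last exact: L_ideal.
congr (ideal_sum _ (ideal_span _)); apply/seteqP; split=> g /=.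
  by move=> [k /= pqk <-]; apply: map_f; rewrite mem_index_iota.
by move=> /mapP[k]; rewrite mem_index_iota => pqk ->; exists k.
Qed.

(** * Intersections of components of the singular fiber *)

Section Components.
Variables n i j : nat.
Hypotheses (hnm : (n <= m)%N) (hij : (i < j)%N) (hj : (j <= n)%N).
Implicit Type Q : set Rm.

Let I0 := ideal_sum (Icomp R m n i) (Icomp R m n j).

Lemma Icomp_ideal l : is_ideal (Icomp R m n l).
Proof. by apply: ideal_sum_ideal; exact: ideal_span_ideal. Qed.

Lemma Icomp_sum_ideal : is_ideal I0.
Proof. by apply: ideal_sum_ideal; exact: Icomp_ideal. Qed.

Lemma Icomp_subP l Q : is_ideal Q -> Icomp R m n l `<=` Q <->
  L R m l (n + 1 - l) 1 `<=` Q /\ (forall k, (k <= m)%N -> Q (jet_eq R m n k)).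
Proof.
move=> hQ; rewrite (ideal_sum_subP (L_ideal _ _ _) (ideal_span_ideal _) hQ).
split=> -[LQ fQ]; split=> //.
  by move=> k km; apply: fQ; apply: sub_ideal_span; exists k.
by apply: ideal_span_min => // _ [k /= km <-]; exact: fQ.
Qed.

(** As i < j, the sum of L_(i,n+1-i,1) and L_(j,n+1-j,1) is L_(j,n+1-i,1). *)
Lemma Icomp_sum_subP Q : is_ideal Q -> I0 `<=` Q <->
  L R m j (n + 1 - i) 1 `<=` Q /\ (forall k, (k <= m)%N -> Q (jet_eq R m n k)).
Proof.
move=> hQ; rewrite (ideal_sum_subP (Icomp_ideal _) (Icomp_ideal _) hQ).
rewrite !(Icomp_subP _ hQ); split=> [[[Li fQ] [Lj _]]|[LQ fQ]].
  split=> //; apply/L_subP => //.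
  have [_ Qy _] := (L_subP _ _ _ hQ).1 Li.
  by have [Qx _ Qz] := (L_subP _ _ _ hQ).1 Lj.
by split; split=> //; apply: subset_trans LQ; apply: L_subset => //; lia.
Qed.

Section PrimeOverSum.
Variable Q : set Rm.
Hypotheses (hQ : is_prime_ideal Q)
  (fQ : forall k, (k <= m)%N -> Q (jet_eq R m n k)).

Let hQ' : is_ideal Q. Proof. by case: hQ. Qed.

(** The equation of order n + 1 reduces to -z_1^(n+1). *)
Lemma prime_contains_z1 p q : (n.+1 < p + q)%N -> (n < m)%N ->
  L R m p q 1 `<=` Q -> L R m p q 2 `<=` Q.
Proof.
move=> pqn nm LQ; have [_ _ <-] := adjoin_L p q 1.
apply: adjoin_min => //; apply: (prime_expr hQ (k := n.+1)).
have := @jet_eq_z n p q 1 Q hQ' LQ; rewrite muln1 => /(_ pqn) Qz.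
rewrite -[_ ^+ _]opprK; apply: ideal_opp => //.
by apply: (ideal_congr hQ' _ (fQ nm)); rewrite -opprB; exact: ideal_opp.
Qed.

(** As long as p + q < E, the equation of order p + q reduces to x_p y_q, so
    that Q contains x_p or y_q, and p or q can be increased. *)
Lemma prime_contains_L p q r E : L R m p q r `<=` Q -> (p + q <= E)%N ->
  (E <= m.+1)%N -> (E <= n.+1 * r)%N ->
  exists p' q', [/\ (p <= p')%N, (q <= q')%N, (p' + q')%N = E &
                    L R m p' q' r `<=` Q].
Proof.
move=> + + Em En; have [d] := ubnP (E - (p + q)).
elim: d p q => // d IHd p q pqd LQ; rewrite leq_eqVlt => /orP[/eqP pqE|pqE].
  by exists p, q.
have [_ _ QM] := hQ.
have [Qx|Qy] : Q x`_p \/ Q y`_q.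
  apply: QM; have pqm : (p + q <= m)%N by lia.
  apply: (ideal_congr hQ' _ (fQ pqm)).
  rewrite -opprB; apply: ideal_opp => //.
  by apply: (@jet_eq_xy n p q r) => //; lia.
- have [|||p' [q' [pp' qq' pqE' LQ']]] := IHd p.+1 q; try by lia.
    by have [<- _ _] := adjoin_L p q r; exact: adjoin_min.
  by exists p', q'; split=> //; lia.
- have [|||p' [q' [pp' qq' pqE' LQ']]] := IHd p q.+1; try by lia.
    by have [_ <- _] := adjoin_L p q r; exact: adjoin_min.
  by exists p', q'; split=> //; lia.
Qed.

End PrimeOverSum.

(** The jets (t^p, 0, 0) and (0, t^q, 0) satisfy all equations of the jet ideal,
    while x_p or y_q does not vanish there. *)
Lemma L_not_sub_jet_ideal p q r p' q' r' k : (k <= m.+1)%N ->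
  (p < p')%N && (p <= m)%N || (q < q')%N && (q <= m)%N ->
  ~ L R m p' q' r' `<=` jet_ideal n p q r k.
Proof.
move=> km lt_pq LJ; have [Lx Ly _] := L_mem p' q' r'.
case/orP: lt_pq => /andP[lt_p pm].
  have arc0 : monomial_arc p (q + m.+1) (r + m.+1) x`_p = 0.
    apply: (@monomial_arc_jet_ideal n p (q + m.+1) (r + m.+1) p q r k);
      [exact: km|lia|lia|lia|lia|nia|by apply: LJ; exact: Lx].
  have [arcx _ _] := monomial_arc_coef p (q + m.+1) (r + m.+1) pm.
  by move/eqP: arc0; rewrite arcx eqxx oner_eq0.
have arc0 : monomial_arc (p + m.+1) q (r + m.+1) y`_q = 0.
  apply: (@monomial_arc_jet_ideal n (p + m.+1) q (r + m.+1) p q r k);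
    [exact: km|lia|lia|lia|lia|nia|by apply: LJ; exact: Ly].
have [_ arcy _] := monomial_arc_coef (p + m.+1) q (r + m.+1) pm.
by move/eqP: arc0; rewrite arcy eqxx oner_eq0.
Qed.

Lemma Zcomp_inter : Zcomp R m n i `&` Zcomp R m n j = V I0.
Proof. by apply: V_ideal_sum; exact: Icomp_ideal. Qed.

Lemma single_component P : is_prime_ideal P -> I0 `<=` P ->
  (forall Q, is_prime_ideal Q -> I0 `<=` Q -> P `<=` Q) ->
  [/\ Iinter R m n i j = P, Zcomp R m n i `&` Zcomp R m n j = V P &
      irreducible (V P)].
Proof.
move=> hP IP Pmin; split; last exact: prime_irreducible.
- apply/seteqP; split=> g.
    by move=> /(radical_primeP g Icomp_sum_ideal); exact.
  move=> Pg; apply/(radical_primeP g Icomp_sum_ideal) => Q hQ IQ.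
  exact: Pmin Pg.
- rewrite Zcomp_inter; apply/seteqP; split=> Q [hQ].
    by move=> IQ; split=> //; exact: Pmin.
  by move=> PQ; split=> //; exact: subset_trans PQ.
Qed.

(** All the equations lie in L_(j,n+1-i,1), because n < j + (n + 1 - i). *)
Lemma inter_m_eq_n : m = n ->
  [/\ Iinter R m n i j = L R m j (n + 1 - i) 1,
      Zcomp R m n i `&` Zcomp R m n j = V (L R m j (n + 1 - i) 1) &
      irreducible (V (L R m j (n + 1 - i) 1))].
Proof.
move=> mn; have hL := L_ideal j (n + 1 - i) 1.
apply: single_component; first exact: L_prime.
  apply/(Icomp_sum_subP hL); split=> // k km.
  by apply: (@jet_eq_low n j (n + 1 - i) 1) => //; lia.
by move=> Q hQ; have hQ' : is_ideal Q by [case: hQ];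
  move=> /(Icomp_sum_subP hQ')[].
Qed.

(** Once z_1 is added, all the equations lie in the ideal, because
    m < j + (n + 1 - i) and m < 2n + 2. *)
Lemma inter_m_near_n : (1 <= m - n <= j - i)%N ->
  [/\ Iinter R m n i j = L R m j (n + 1 - i) 2,
      Zcomp R m n i `&` Zcomp R m n j = V (L R m j (n + 1 - i) 2) &
      irreducible (V (L R m j (n + 1 - i) 2))].
Proof.
move=> mn; have hL := L_ideal j (n + 1 - i) 2.
apply: single_component; first exact: L_prime.
  apply/(Icomp_sum_subP hL); split; first exact: L_subset.
  by move=> k km; apply: (@jet_eq_low n j (n + 1 - i) 2) => //; lia.
move=> Q hQ; have hQ' : is_ideal Q by case: hQ.
by move=> /(Icomp_sum_subP hQ')[LQ fQ]; apply: prime_contains_z1 => //; lia.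
Qed.

(** Raising p + q from j + (n + 1 - i) to m + 1 leaves the pairs
    (j + u, m + 1 - j - u), and then no equation is left. *)
Lemma inter_m_small : (j - i <= m - n)%N -> (m < 2 * n + 2)%N ->
  Iinter R m n i j =
    \bigcap_(u < (m - n - (j - i)).+1) L R m (j + u) (m - j - u + 1) 2 /\
  irreducible_decomposition (Zcomp R m n i `&` Zcomp R m n j)
    (m - n - (j - i)).+1 (fun u => V (L R m (j + u) (m - j - u + 1) 2)).
Proof.
move=> jimn mn; rewrite Zcomp_inter.
apply: minimal_primes_decomposition Icomp_sum_ideal _ _ _.
- move=> u uN; split; first exact: L_prime.
  have hL := L_ideal (j + u) (m - j - u + 1) 2.
  apply/(Icomp_sum_subP hL); split; first by apply: L_subset => //; lia.
  by move=> k km; apply: (@jet_eq_low n (j + u) (m - j - u + 1) 2) => //; lia.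
- move=> Q hQ; have hQ' : is_ideal Q by case: hQ.
  move=> /(Icomp_sum_subP hQ')[LQ fQ].
  have L2Q : L R m j (n + 1 - i) 2 `<=` Q.
    by apply: prime_contains_z1 => //; lia.
  have [|||p [q [jp iq pqm LpqQ]]] :=
    prime_contains_L hQ fQ L2Q (E := m.+1); try by lia.
  exists (p - j)%N; first by lia.
  have [-> ->] : (j + (p - j))%N = p /\ (m - j - (p - j) + 1)%N = q by lia.
  exact: LpqQ.
- move=> u v uN vN uv.
  (* for k = 0 no equation is adjoined, and the jet ideal is L itself *)
  by apply: (@L_not_sub_jet_ideal _ _ _ _ _ _ 0) => //; lia.
Qed.

(** Raising p + q stops at 2n + 2, where z_2^(n+1) enters the equations. *)
Lemma inter_m_large : (2 * n + 2 <= m)%N ->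
  [/\ Iinter R m n i j =
        \bigcap_(u < (n + 1 - (j - i)).+1)
          ideal_sum (L R m (j + u) (2 * n + 2 - j - u) 2)
                    (jet_eqs_from R m n (2 * n + 2)),
      forall u : nat, (u <= n + 1 - (j - i))%N ->
        is_prime_ideal
          (ideal_sum (L R m (j + u) (2 * n + 2 - j - u) 2)
                     (jet_eqs_from R m n (2 * n + 2))) &
      irreducible_decomposition (Zcomp R m n i `&` Zcomp R m n j)
        (n + 1 - (j - i)).+1
        (fun u => V (ideal_sum (L R m (j + u) (2 * n + 2 - j - u) 2)
                               (jet_eqs_from R m n (2 * n + 2))))].
Proof.
move=> mn; rewrite Zcomp_inter.
pose P u := ideal_sum (L R m (j + u) (2 * n + 2 - j - u) 2)
                      (jet_eqs_from R m n (2 * n + 2)).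
have PE u : (u <= n + 1 - (j - i))%N ->
    P u = jet_ideal n (j + u) (2 * n + 2 - j - u) 2 m.+1.
  by move=> uN; apply: ideal_sum_jet_eqs_from; lia.
have Pprime u : (u <= n + 1 - (j - i))%N -> is_prime_ideal (P u).
  by move=> uN; rewrite PE //; apply: jet_ideal_prime; lia.
have [||| radE decE] := @minimal_primes_decomposition _ I0
    (n + 1 - (j - i)).+1 P Icomp_sum_ideal; last by split.
- move=> u uN; split; first exact: Pprime.
  have [hP _ _] := Pprime u uN; apply/(Icomp_sum_subP hP).
  rewrite PE // in hP *.
  have LP := @sub_jet_ideal n (j + u) (2 * n + 2 - j - u) 2 m.+1.
  split; first by apply: subset_trans LP; apply: L_subset => //; lia.
  move=> k km; case: (ltnP k (2 * n + 2)) => kn.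
    by apply: (jet_eq_low hP LP); lia.
  by apply: jet_ideal_mem; lia.
- move=> Q hQ; have hQ' : is_ideal Q by case: hQ.
  move=> /(Icomp_sum_subP hQ')[LQ fQ].
  have L2Q : L R m j (n + 1 - i) 2 `<=` Q.
    by apply: prime_contains_z1 => //; lia.
  have [|||p [q [jp iq pqm LpqQ]]] :=
    prime_contains_L hQ fQ L2Q (E := (2 * n + 2)%N); try by lia.
  exists (p - j)%N; first by lia.
  rewrite PE; last by lia.
  have [-> ->] : (j + (p - j))%N = p /\ (2 * n + 2 - j - (p - j))%N = q by lia.
  by apply: jet_ideal_subP => // k /andP[_ km]; exact: fQ.
- move=> u v uN vN uv; rewrite (PE v) // => PuPv.
  apply: (@L_not_sub_jet_ideal (j + v) (2 * n + 2 - j - v) 2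
            (j + u) (2 * n + 2 - j - u) 2 m.+1) => //; first by lia.
  by apply: subset_trans PuPv; rewrite PE //; exact: sub_jet_ideal.
Qed.

End Components.

End Jets.

Theorem theorem2p10 (R : realType) (n m i j : nat)
    (hn : (2 <= n)%N) (hnm : (n <= m)%N)
    (hi : (1 <= i)%N) (hij : (i < j)%N) (hj : (j <= n)%N) :
  [/\ m = n ->
        [/\ Iinter R m n i j = L R m j (n + 1 - i) 1,
            Zcomp R m n i `&` Zcomp R m n j = V (L R m j (n + 1 - i) 1) &
            irreducible (V (L R m j (n + 1 - i) 1))],
      (1 <= m - n <= j - i)%N ->
        [/\ Iinter R m n i j = L R m j (n + 1 - i) 2,
            Zcomp R m n i `&` Zcomp R m n j = V (L R m j (n + 1 - i) 2) &
            irreducible (V (L R m j (n + 1 - i) 2))],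
      (j - i <= m - n)%N -> (m < 2 * n + 2)%N ->
        Iinter R m n i j =
          \bigcap_(u < (m - n - (j - i)).+1) L R m (j + u) (m - j - u + 1) 2 /\
        irreducible_decomposition (Zcomp R m n i `&` Zcomp R m n j)
          (m - n - (j - i)).+1
          (fun u => V (L R m (j + u) (m - j - u + 1) 2)) &
      (2 * n + 2 <= m)%N ->
        [/\ Iinter R m n i j =
              \bigcap_(u < (n + 1 - (j - i)).+1)
                ideal_sum (L R m (j + u) (2 * n + 2 - j - u) 2)
                          (jet_eqs_from R m n (2 * n + 2)),
            forall u : nat, (u <= n + 1 - (j - i))%N ->
              is_prime_ideal
                (ideal_sum (L R m (j + u) (2 * n + 2 - j - u) 2)
                           (jet_eqs_from R m n (2 * n + 2))) &
            irreducible_decomposition (Zcomp R m n i `&` Zcomp R m n j)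
              (n + 1 - (j - i)).+1
              (fun u => V (ideal_sum (L R m (j + u) (2 * n + 2 - j - u) 2)
                                     (jet_eqs_from R m n (2 * n + 2))))]].
Proof.
split; [exact: inter_m_eq_n|exact: inter_m_near_n|exact: inter_m_small|].
exact: inter_m_large.
Qed.
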